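(* Let $\Omega\subset\mathbb{R}^n$ be a bounded domain. For every $f\in C(\partial\Omega)$ and every $D\subset\Omega$, the gradient constraint problem $$\min\{\Delta_\infty u,\ |Du|-\chi_D\}=0\ \text{ in }\Omega,\qquad u=f\ \text{ on }\partial\Omega,$$ has at least one viscosity solution.
   Context: $\Delta_\infty u(x)=\sum_{i,j=1}^n u_{ij}(x)u_i(x)u_j(x)$ is the infinity Laplacian, $\chi_E$ is the characteristic function of a set $E$, and $\operatorname{int}D$, $\overline D$ are the topological interior and closure of $D$. The condition $u=f$ on $\partial\Omega$ means $\lim_{x\to z}u(x)=f(z)$ for all $z\in\partial\Omega$. An upper semicontinuous $u:\Omega\to\mathbb{R}$ is a viscosity subsolution of $\min\{\Delta_\infty u,|Du|-\chi_D\}=0$ in $\Omega$ if, whenever $x\in\Omega$ and $\varphi\in C^2(\Omega)$ are such that $u-\varphi$ has a strict local maximum at $x$, then $\min\{\Delta_\infty\varphi(x),|D\varphi(x)|-\chi_{\operatorname{int}D}(x)\}\ge 0$. A lower semicontinuous $v:\Omega\to\mathbb{R}$ is a viscosity supersolution if, whenever $x\in\Omega$ and $\phi\in C^2(\Omega)$ are such that $v-\phi$ has a strict local minimum at $x$, then $\min\{\Delta_\infty\phi(x),|D\phi(x)|-\chi_{\overline D}(x)\}\le 0$. A continuous function on $\Omega$ is a viscosity solution of the equation if it is both a viscosity subsolution and a viscosity supersolution. *)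

(* Defs.v *)
From HB Require Import structures.
From mathcomp Require Import all_boot all_order all_algebra.
From mathcomp Require Import all_classical all_reals all_analysis.

Set Implicit Arguments.
Unset Strict Implicit.
Unset Printing Implicit Defensive.

Import Order.TTheory GRing.Theory Num.Theory.
Import numFieldNormedType.Exports.

Local Open Scope classical_set_scope.
Local Open Scope ring_scope.

(* Functions on a subset of R^n are represented by total functions
   'rV[R]_n -> R whose values outside the subset are irrelevant. All the
   notions below only depend on the values on Omega when Omega is open. *)

Section EuclideanSpace.
Context {R : realType} {n : nat}.
Implicit Types (Omega : set 'rV[R]_n) (u phi : 'rV[R]_n -> R) (x : 'rV[R]_n).

Definition is_domain Omega := [/\ open Omega, connected Omega & Omega !=set0].

Definition boundary (A : set 'rV[R]_n) := closure A `\` A°.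

(* The norm `|x| of the library on 'rV[R]_n is the sup norm: it induces the
   same topology and bounded sets, but it is not the norm used for |Du|. *)
Definition norm2 (v : 'rV[R]_n) : R := Num.sqrt (\sum_(i < n) v 0 i ^+ 2).

Definition partial (i : 'I_n) phi : 'rV[R]_n -> R :=
  fun x => 'D_(delta_mx 0 i) phi x.

Definition gradient phi x : 'rV[R]_n := \row_(i < n) partial i phi x.

Definition inf_laplacian phi x : R :=
  \sum_(i < n) \sum_(j < n)
    partial j (partial i phi) x * partial i phi x * partial j phi x.

Definition C1_on Omega phi :=
  forall x, Omega x -> {for x, continuous phi} /\
    forall i, derivable phi x (delta_mx 0 i) /\
              {for x, continuous (partial i phi)}.

Definition C2_on Omega phi :=
  C1_on Omega phi /\ forall i, C1_on Omega (partial i phi).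

Definition upper_semicontinuous_on Omega u :=
  forall x, Omega x -> forall a, u x < a ->
    \forall y \near within Omega (nbhs x), u y < a.

Definition lower_semicontinuous_on Omega u :=
  forall x, Omega x -> forall a, a < u x ->
    \forall y \near within Omega (nbhs x), a < u y.

(* x^' is the filter of punctured neighborhoods of x. *)
Definition strict_local_max u x := \forall y \near x^', u y < u x.

Definition strict_local_min u x := \forall y \near x^', u x < u y.

End EuclideanSpace.

Section GradientConstraint.
Context {R : realType} {n : nat}.
Implicit Types (Omega D : set 'rV[R]_n) (u v phi : 'rV[R]_n -> R).

Definition viscosity_subsolution Omega D u :=
  upper_semicontinuous_on Omega u /\
  forall x phi, Omega x -> C2_on Omega phi ->
    strict_local_max (fun y => u y - phi y) x ->
    0 <= Num.min (inf_laplacian phi x)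
                 (norm2 (gradient phi x) - \1_(D°) x).

Definition viscosity_supersolution Omega D v :=
  lower_semicontinuous_on Omega v /\
  forall x phi, Omega x -> C2_on Omega phi ->
    strict_local_min (fun y => v y - phi y) x ->
    Num.min (inf_laplacian phi x)
            (norm2 (gradient phi x) - \1_(closure D) x) <= 0.

Definition viscosity_solution Omega D u :=
  [/\ {within Omega, continuous u},
      viscosity_subsolution Omega D u &
      viscosity_supersolution Omega D u].

Definition boundary_condition Omega (f u : 'rV[R]_n -> R) :=
  forall z, boundary Omega z -> u x @[x --> within Omega (nbhs z)] --> f z.

End GradientConstraint.

(* Main.v *)
(* Perron's method. Subsolutions are in particular infinity-subharmonic, so they
   can be compared with the radial functions a + b |x - z|^(1/2), b > 0, which
   are strictly infinity-superharmonic away from z. With z on the boundary this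
   keeps all subsolutions below upper barriers; with z inside it gives a Hoelder
   estimate, uniform over the family, so that the supremum u of the subsolutions
   lying below f on the boundary is continuous. It is again a subsolution, and a
   bump argument shows that it is a supersolution: where this fails, a test
   function touching u from below is a classical strict subsolution and a small
   lift of it would enlarge u. The functions a - b |x - z|^(1/2) with z on the
   boundary and b large are subsolutions with gradient at least 1, and serve as
   lower barriers; hence u takes the boundary values f. The square root replaces
   the usual cone because of its strict concavity, and smoothing it to
   (|x - z|^2 + d)^(1/4) turns it into a global C^2 test function. *)
Require Import Defs.
From HB Require Import structures.
From mathcomp Require Import all_boot all_order all_algebra.
From mathcomp Require Import all_classical all_reals all_analysis.
From mathcomp Require Import ring lra.
Import Order.TTheory GRing.Theory Num.Theory.
Import numFieldNormedType.Exports.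
Local Open Scope classical_set_scope.
Local Open Scope ring_scope.

(** * Directional derivatives and one-variable calculus *)

Lemma is_derive_line {R : realType} {V : normedModType R} (f : V -> R)
    (x v : V) (t d : R) :
  is_derive (t *: v + x) v f d ->
  is_derive t 1 (fun s => f (s *: v + x)) d.
Proof.
move=> [fd fE].
have E : (fun h => h^-1 *:
      (((fun s => f (s *: v + x)) \o shift t) (h *: (1 : R)) -
       f (t *: v + x))) =
    (fun h => h^-1 *:
      ((f \o shift (t *: v + x)) (h *: v) - f (t *: v + x))).
  by apply/funext => h /=; rewrite [h *: (1 : R)]mulr1 scalerDl addrA.
by apply: DeriveDef; [rewrite /derivable E | rewrite /derive E].
Qed.

(** Together with [is_derive_line] this carries differentiation rules for functions of one real
    variable over to directional derivatives. *)
Lemma is_derive_at0 {R : realType} {V : normedModType R} (f : V -> R)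
    (x v : V) (d : R) :
  is_derive (0 : R) 1 (fun s => f (s *: v + x)) d -> is_derive x v f d.
Proof.
move=> [fd fE].
have E : (fun h => h^-1 *:
      (((fun s => f (s *: v + x)) \o shift 0) (h *: (1 : R)) -
       f (0 *: v + x))) =
    (fun h => h^-1 *: ((f \o shift x) (h *: v) - f x)).
  by apply/funext => h /=; rewrite [h *: (1 : R)]mulr1 addr0 scale0r add0r.
by apply: DeriveDef; [rewrite /derivable -E | rewrite /derive -E].
Qed.

Lemma is_derive_continuous {R : realType} (f : R -> R) (x d : R) :
  is_derive x 1 f d -> {for x, continuous f}.
Proof.
by move=> [fd _]; exact/differentiable_continuous/derivable1_diffP.
Qed.

(** A form of the mean value theorem in which the increment [r] may have either sign, as needed for
    difference quotients with two-sided step. *)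
Lemma mean_value_at0 {R : realType} (f df : R -> R) (r : R) :
  (forall t : R, `|t| <= `|r| -> is_derive t 1 f (df t)) ->
  exists2 c, `|c| <= `|r| & f r - f 0 = df c * r.
Proof.
move=> fd.
have cf a b : (forall t, t \in `[a, b] -> `|t| <= `|r|) ->
    {within `[a, b], continuous f}.
  move=> ab; apply: continuous_in_subspaceT => t; rewrite inE => tab.
  by apply: is_derive_continuous (fd _ (ab _ tab)).
have [r0|r0] := leP 0 r.
  have rb t : t \in `[0, r] -> `|t| <= `|r|.
    by rewrite in_itv/= => /andP[t0 tr]; rewrite !ger0_norm.
  have [t t0|c cr ->] := @MVT_segment R f df 0 r r0 _ (cf _ _ rb).
    by apply/fd/rb/subset_itv_oo_cc.
  by exists c; [exact: rb | rewrite subr0].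
have rb t : t \in `[r, 0] -> `|t| <= `|r|.
  rewrite in_itv/= => /andP[rt t0]; rewrite !ler0_norm ?lerN2//.
  exact: ltW.
have [t t0|c cr E] := @MVT_segment R f df r 0 (ltW r0) _ (cf _ _ rb).
  by apply/fd/rb/subset_itv_oo_cc.
exists c; first exact: rb.
by rewrite -[LHS]opprB E sub0r mulrN opprK.
Qed.

(* The quotient along [a + s e] is split at [x + h a]; on the second leg the
   mean value theorem and the continuity of [df] give the limit [s * df x]. *)
Lemma is_derive_addv {R : realType} {V : normedModType R} (f df : V -> R)
    (x a e : V) (A s : R) :
  is_derive x a f A -> (\forall y \near x, is_derive y e f (df y)) ->
  {for x, continuous df} ->
  is_derive x (a + s *: e) f (A + s * df x).
Proof.
move=> [fa fA] fe dfc.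
suff Q : (fun h => h^-1 *: ((f \o shift x) (h *: (a + s *: e)) - f x)) @ 0^'
    --> A + s * df x.
  by apply: DeriveDef; [apply/cvg_ex; eexists; exact: Q | exact: cvg_lim Q].
have -> : (fun h => h^-1 *: ((f \o shift x) (h *: (a + s *: e)) - f x)) =
    (fun h => h^-1 *: ((f \o shift x) (h *: a) - f x)) +
    (fun h => h^-1 * (f ((h * s) *: e + (h *: a + x)) - f (h *: a + x))).
  apply/funext => h; rewrite fctE /=.
  have -> : h *: (a + s *: e) + x = (h * s) *: e + (h *: a + x).
    by rewrite scalerDr scalerA addrA [_ *: e + _]addrC.
  rewrite -[X in _ = _ + X]/(h^-1 *: _) -scalerDr; congr (_ *: _).
  by rewrite /=; ring.
apply: cvgD; first by rewrite -fA.
apply/cvgrPdist_le => eps eps0.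
have es0 : 0 < eps / (`|s| + 1) by rewrite divr_gt0// ltr_wpDl.
move/cvgrPdist_le : dfc => /(_ _ es0) dfn.
have : \forall y \near x, is_derive y e f (df y) /\
    `|df x - df y| <= eps / (`|s| + 1).
  near=> y; split; first by near: y.
  by near: y; exact: dfn.
move/nbhs_ballP => [d /= d0 dP].
(* [|h| * K] bounds the distance to [x] from every point of both legs of the path. *)
pose K := `|s| * `|e| + `|a| + 1.
have K0 : 0 < K by rewrite ltr_wpDl// addr_ge0// mulr_ge0.
have near_small : \forall h \near 0^', h != 0 :> R /\ `|h| * K < d.
  near=> h; split; first by near: h; exact: nbhs_dnbhs_neq.
  rewrite -ltr_pdivlMr//; near: h; apply: dnbhs0_lt.
  by rewrite divr_gt0.
apply: filterS near_small => h [h0 hK].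
have inball t : `|t| <= `|h * s| -> ball x d (t *: e + (h *: a + x)).
  move=> ts; rewrite -ball_normE /ball_/=.
  rewrite [_ + (_ + x)]addrA opprD addrCA subrr addr0 normrN.
  apply: le_lt_trans hK; apply: (le_trans (ler_normD _ _)).
  have : `|t| * `|e| <= `|h| * `|s| * `|e| by rewrite -normrM ler_wpM2r.
  by have := normr_ge0 h; rewrite !normrZ /K; lra.
have [t ts|c cs E] := @mean_value_at0 R (fun t => f (t *: e + (h *: a + x)))
    (fun t => df (t *: e + (h *: a + x))) (h * s).
  by apply: is_derive_line; have [] := dP _ (inball _ ts).
move: E; rewrite scale0r add0r => ->.
have -> : h^-1 * (df (c *: e + (h *: a + x)) * (h * s)) =
    s * df (c *: e + (h *: a + x)) by field.
rewrite -mulrBr normrM.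
apply: (@le_trans _ _ (`|s| * (eps / (`|s| + 1)))).
  by rewrite ler_wpM2l//; have [] := dP _ (inball _ cs).
by rewrite mulrA ler_pdivrMr ?ltr_wpDl//; lra.
Unshelve. all: by end_near. Qed.

(** If [c] were positive, [g1] would be positive just to the right of 0, and the mean value theorem
    would give [g h > g 0] for a small [h > 0]. *)
Lemma second_order_max {R : realType} (g g1 : R -> R) (c : R) :
  (\forall t \near (0 : R), is_derive (t : R) (1 : R) g (g1 t)) ->
  is_derive (0 : R) 1 g1 c -> (\forall t \near (0 : R), g t <= g 0) ->
  g1 0 = 0 /\ c <= 0.
Proof.
move=> gd g1d gmax.
have [e /= e0 eP] : exists2 e : R, 0 < e &
    forall t : R, `|t| < e -> is_derive (t : R) (1 : R) g (g1 t) /\ g t <= g 0.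
  have : \forall t \near (0 : R), is_derive (t : R) (1 : R) g (g1 t) /\
      g t <= g 0.
    by near=> t; split; near: t.
  move/nbhs_ballP => [e e0 eP]; exists e => // t te.
  by apply: eP; rewrite -ball_normE /ball_/= sub0r normrN.
have ie t : t \in `](- e), e[ -> `|t| < e by rewrite in_itv/= ltr_norml.
have g10 : g1 0 = 0.
  have ne : - e <= e by lra.
  have [_ D0] : is_derive (0 : R) 1 g 0.
    apply: (derive1_at_max ne) => [t /ie/eP[[]]//||t /ie/eP[]//].
    by rewrite in_itv/= e0 oppr_lt0 e0.
  have [|[_ D1] _] := eP 0 _; first by rewrite normr0.
  by rewrite -D1 D0.
split => //; rewrite leNgt; apply/negP => c0.
have : (fun h => h^-1 *: ((g1 \o shift 0) (h *: (1 : R)) - g1 0)) @ 0^' --> c.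
  by case: g1d => d1 <-.
move/cvgr_gt => /(_ _ c0) /nbhs_ballP[d /= d0 dP].
pose h := Num.min d e / 2.
have m0 : 0 < Num.min d e by rewrite lt_min d0.
have h0 : 0 < h by rewrite /h divr_gt0.
have hm : h < Num.min d e by rewrite /h; lra.
move: hm; rewrite lt_min => /andP[hd he].
have be t : t \in `[0, h] -> `|t| < e.
  rewrite in_itv/= => /andP[t0 th]; rewrite ger0_norm//.
  exact: le_lt_trans he.
have [t t0h||s sh +] := @MVT R g g1 0 h h0.
- by have [] := eP _ (be _ (subset_itv_oo_cc t0h)).
- apply: continuous_in_subspaceT => t; rewrite inE => t0h.
  by have [/is_derive_continuous] := eP _ (be _ t0h).
rewrite subr0 => gE.
have : 0 < g1 s * h.
  rewrite mulr_gt0//; move: sh; rewrite in_itv/= => /andP[s0 sh].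
  have /= := dP s; rewrite [s *: _]mulr1 addr0 g10 subr0.
  rewrite pmulr_rgt0 ?invr_gt0//; apply; last by rewrite gt_eqF.
  rewrite -ball_normE /ball_/= sub0r normrN gtr0_norm//.
  exact: lt_trans hd.
have [|_] := eP h _; first by rewrite gtr0_norm.
lra.
Unshelve. all: by end_near. Qed.

(** * Second-order conditions at a local maximum *)

Section TwiceDifferentiable.
Context {R : realType} {n : nat}.
Notation V := 'rV[R]_n.
Implicit Types (Omega : set V) (phi psi : V -> R) (x y xi : V).

(** The coordinates of [xi] are added one at a time by [is_derive_addv], which rests on the
    continuity of the partial derivatives. *)
Lemma C1_directional Omega phi x xi : open Omega -> C1_on Omega phi ->
  Omega x -> is_derive x xi phi (\sum_(i < n) xi 0 i * partial i phi x).
Proof.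
move=> Oo C1 Ox; rewrite [xi in is_derive _ xi](row_sum_delta xi).
elim: (index_enum _) => [|i r IHr].
  by rewrite !big_nil; apply: DeriveDef; [exact: derivable0 | exact: derive0].
rewrite !big_cons addrC [X in is_derive _ _ _ X]addrC.
apply: is_derive_addv => //; last by have [_ /(_ i)[]] := C1 x Ox.
near=> y; apply: derivableP.
have [|_ /(_ i)[]//] := C1 y.
by near: y; exact: open_nbhs_nbhs.
Unshelve. all: by end_near. Qed.

Lemma near_line y xi (P : V -> Prop) :
  (\forall z \near y, P z) -> \forall t \near (0 : R), P (t *: xi + y).
Proof.
move=> yP.
have : t *: xi + y @[t --> (0 : R)] --> 0 *: xi + y.
  by apply: cvgD; [apply: cvgZr_tmp; exact: cvg_id | exact: cvg_cst].
by rewrite scale0r add0r; apply.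
Qed.

(** The one-variable test is applied on the line through [y] in an arbitrary direction [zeta]; basis
    vectors give the vanishing gradient, and [xi] gives the sign of the Hessian form. *)
Lemma C2_local_max Omega phi y xi : open Omega -> C2_on Omega phi ->
  Omega y -> (\forall z \near y, phi z <= phi y) ->
  (forall i, partial i phi y = 0) /\
  \sum_(i < n) \sum_(j < n) partial j (partial i phi) y * xi 0 i * xi 0 j <= 0.
Proof.
move=> Oo [C1 C2] Oy ymax.
suff H (zeta : V) : \sum_(i < n) zeta 0 i * partial i phi y = 0 /\
    \sum_(i < n) zeta 0 i * \sum_(j < n) zeta 0 j * partial j (partial i phi) y
      <= 0.
  split=> [i|].
    have [+ _] := H (delta_mx 0 i); rewrite (bigD1 i)//= mxE !eqxx mul1r.
    rewrite big1 ?addr0// => j ji; rewrite mxE eqxx/= (negbTE ji) mul0r//.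
  have [_] := H xi; apply: le_trans; rewrite le_eqVlt; apply/orP; left.
  apply/eqP/eq_bigr => i _; rewrite mulr_sumr; apply: eq_bigr => j _; ring.
have [|||] := @second_order_max R (fun t => phi (t *: zeta + y))
    (fun t => \sum_(i < n) zeta 0 i * partial i phi (t *: zeta + y))
    (\sum_(i < n) zeta 0 i *
       \sum_(j < n) zeta 0 j * partial j (partial i phi) y).
- have : \forall z \near y, Omega z by exact: open_nbhs_nbhs.
  move/(near_line y zeta Omega); apply: filterS => t Ot.
  by apply: is_derive_line; exact: (C1_directional Omega).
- have -> : (fun t : R => \sum_(i < n) zeta 0 i * partial i phi (t *: zeta + y))
      = \sum_(i < n)
          (zeta 0 i \*: (fun t : R => partial i phi (t *: zeta + y))).
    by apply/funext => t; rewrite fct_sumE.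
  apply: is_derive_sum => i; apply: is_deriveZ; apply: is_derive_line.
  by rewrite scale0r add0r; exact: (C1_directional Omega).
- by rewrite scale0r add0r; exact: (near_line y zeta (fun z => phi z <= phi y)).
- by rewrite scale0r add0r.
Qed.

End TwiceDifferentiable.

(** * Chain rule and pointwise continuity *)

Lemma is_derive_comp_line {R : realType} {V : normedModType R} (G : R -> R)
    (f : V -> R) (x v : V) (a b : R) :
  is_derive (f x) (1 : R) G a -> is_derive x v f b ->
  is_derive x v (fun y => G (f y)) (a * b).
Proof.
move=> Ga fb; apply: is_derive_at0.
apply: (@is_derive1_comp _ G (fun s : R => f (s *: v + x))).
  by rewrite scale0r add0r.
by apply: is_derive_line; rewrite scale0r add0r.
Qed.

Lemma near_eq_continuous {R : realType} {T : topologicalType} (f g : T -> R)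
    (x : T) : (\forall y \near x, f y = g y) ->
  {for x, continuous f} -> {for x, continuous g}.
Proof.
move=> fg fc; rewrite /prop_for /continuous_at.
by rewrite -(nbhs_singleton fg); apply: cvg_trans fc; exact: near_eq_cvg.
Qed.

Lemma continuous_sum_ord {R : realType} {T : topologicalType} {n : nat}
    (F : 'I_n -> T -> R) (x : T) : (forall i, {for x, continuous (F i)}) ->
  {for x, continuous (fun z => \sum_(i < n) F i z)}.
Proof.
by move=> Fc; apply: cvg_big => [|i _]; [exact: add_continuous | exact: Fc].
Qed.

Lemma is_derive_sqrB {R : realType} (c t : R) :
  is_derive t 1 (fun s => (s - c) ^+ 2) (2 * (t - c)).
Proof.
have -> : (fun s => (s - c) ^+ 2) = (id - cst c : R -> R) ^+ 2.
  by apply/funext => s; rewrite !fctE.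
apply: is_derive_eq; rewrite !fctE /= subr0 expr1.
by rewrite [_ *: _]mulr1.
Qed.

Section PointwiseContinuity.
Context {R : realType} {T : topologicalType}.
Implicit Types (f g : T -> R) (x : T).

Lemma continuous_funD f g x : {for x, continuous f} -> {for x, continuous g} ->
  {for x, continuous (fun z => f z + g z)}.
Proof. exact: continuousD. Qed.

Lemma continuous_funB f g x : {for x, continuous f} -> {for x, continuous g} ->
  {for x, continuous (fun z => f z - g z)}.
Proof. exact: continuousB. Qed.

Lemma continuous_funM f g x : {for x, continuous f} -> {for x, continuous g} ->
  {for x, continuous (fun z => f z * g z)}.
Proof. exact: continuousM. Qed.

Lemma continuous_near_lt f x (a : R) : {for x, continuous f} -> f x < a ->
  \forall y \near x, f y < a.
Proof. by move=> fc; exact: (cvgr_lt (f x) fc). Qed.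

Lemma continuous_near_gt f x (a : R) : {for x, continuous f} -> a < f x ->
  \forall y \near x, a < f y.
Proof. by move=> fc; exact: (cvgr_gt (f x) fc). Qed.

Lemma continuous_dist_lt f x :
  (forall e, 0 < e -> \forall y \near x, `|f x - f y| < e) ->
  {for x, continuous f}.
Proof. by move=> fe; apply/cvgrPdist_lt. Qed.

End PointwiseContinuity.

(** * Functions of class C^2 with explicit derivatives *)

Section C2Data.
Context {R : realType} {n : nat}.
Notation V := 'rV[R]_n.
Implicit Types (Omega : set V) (phi psi : V -> R) (x y : V).

(** A certificate with candidate first derivatives [g] and second derivatives [h]: on an open set it
    yields both [C2_on] and the values of the partial derivatives, from pointwise facts only. *)
Definition C2_data Omega phi (g : 'I_n -> V -> R)
    (h : 'I_n -> 'I_n -> V -> R) :=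
  forall x, Omega x ->
    {for x, continuous phi} /\ forall i,
    [/\ is_derive x (delta_mx 0 i) phi (g i x), {for x, continuous (g i)} &
        forall j, is_derive x (delta_mx 0 j) (g i) (h i j x) /\
                  {for x, continuous (h i j)}].

Lemma C2_on_data Omega phi : C2_on Omega phi ->
  C2_data Omega phi (fun i => partial i phi)
    (fun i j => partial j (partial i phi)).
Proof.
move=> [C1 C2] x Ox; have [phic phid] := C1 x Ox; split=> // i.
have [di ci] := phid i; have [_ d2] := C2 i x Ox.
split; [exact: (derivableP di) | exact: ci |].
move=> j; have [dij cij] := d2 j; split.
  exact: (derivableP dij).
exact: cij.
Qed.

Lemma C2_data_partial Omega phi g h x i : C2_data Omega phi g h -> Omega x ->
  partial i phi x = g i x.
Proof. by move=> C2 Ox; have [_ /(_ i)[[_ <-]]] := C2 x Ox. Qed.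

Lemma C2_data_partial2 Omega phi g h x i j : open Omega ->
  C2_data Omega phi g h -> Omega x ->
  partial j (partial i phi) x = h i j x.
Proof.
move=> Oo C2 Ox; have [_ /(_ i)[_ _ /(_ j)[[_ <-] _]]] := C2 x Ox.
apply: near_eq_derive; near=> y; apply: (C2_data_partial Omega phi g h) => //.
by near: y; exact: open_nbhs_nbhs.
Unshelve. all: by end_near. Qed.

Lemma C2_data_on Omega phi g h : open Omega ->
  C2_data Omega phi g h -> C2_on Omega phi.
Proof.
move=> Oo C2.
have nearO x : Omega x -> \forall y \near x, Omega y.
  by move=> Ox; exact: open_nbhs_nbhs.
have pg x i : Omega x -> \forall y \near x, g i y = partial i phi y.
  move=> /nearO; apply: filterS => y Oy.
  by rewrite (C2_data_partial _ _ _ _ _ _ C2).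
have ph x i j : Omega x ->
    \forall y \near x, h i j y = partial j (partial i phi) y.
  move=> /nearO; apply: filterS => y Oy.
  by rewrite (C2_data_partial2 _ _ _ _ _ _ _ Oo C2).
split=> [x Ox|i x Ox]; have [phic /[dup] gh /(_ _)] := C2 x Ox.
  split=> // i; have [[d _] c _] := gh i; split=> //.
  exact: near_eq_continuous (pg x i Ox) c.
move=> _; have [_ c hh] := gh i.
split; first exact: near_eq_continuous (pg x i Ox) c.
move=> j; have [[d _] cj] := hh j; split.
  exact: near_eq_derivable (pg x i Ox) d.
exact: near_eq_continuous (ph x i j Ox) cj.
Qed.

Lemma C2_dataB Omega phi psi g h g' h' :
  C2_data Omega phi g h -> C2_data Omega psi g' h' ->
  C2_data Omega (fun x => phi x - psi x) (fun i x => g i x - g' i x)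
    (fun i j x => h i j x - h' i j x).
Proof.
move=> C C' x Ox; have [c d] := C x Ox; have [c' d'] := C' x Ox.
split=> [|i]; first exact: continuous_funB.
have [d1 c1 dj] := d i; have [d1' c1' dj'] := d' i.
split=> [||j]; [exact: is_deriveB|exact: continuous_funB|].
have [dd cc] := dj j; have [dd' cc'] := dj' j.
by split; [exact: is_deriveB|exact: continuous_funB].
Qed.

(** At a maximum of [phi - psi] the gradients agree and the Hessian of the difference is negative
    semidefinite; evaluating its quadratic form at the common gradient compares the infinity
    Laplacians. *)
Lemma touching Omega phi psi y : open Omega ->
  C2_on Omega phi -> C2_on Omega psi -> Omega y ->
  (\forall z \near y, phi z - psi z <= phi y - psi y) ->
  gradient phi y = gradient psi y /\ inf_laplacian phi y <= inf_laplacian psi y.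
Proof.
move=> Oo /C2_on_data Cphi /C2_on_data Cpsi Oy ymax.
have C := C2_dataB _ _ _ _ _ _ _ Cphi Cpsi.
have C2 := C2_data_on _ _ _ _ Oo C.
have [p0 p2] := C2_local_max _ _ y (gradient phi y) Oo C2 Oy ymax.
have E i : partial i phi y = partial i psi y.
  by apply/eqP; rewrite -subr_eq0 -(p0 i) (C2_data_partial _ _ _ _ _ _ C).
split; first by apply/rowP => i; rewrite !mxE E.
rewrite -subr_le0 /inf_laplacian; apply: le_trans p2.
rewrite -sumrB le_eqVlt; apply/orP; left; apply/eqP; apply: eq_bigr => i _.
rewrite -sumrB; apply: eq_bigr => j _.
rewrite (C2_data_partial2 _ _ _ _ y i j Oo C Oy) !mxE (E i) (E j).
by rewrite !mulrBl.
Qed.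

Lemma inf_laplacian_continuous Omega phi x : C2_on Omega phi -> Omega x ->
  {for x, continuous (inf_laplacian phi)}.
Proof.
move=> [C1 C2] Ox; have [_ c1] := C1 x Ox.
apply: continuous_sum_ord => i; apply: continuous_sum_ord => j.
have [_ /(_ j)[_ c2]] := C2 i x Ox.
apply: continuous_funM; last by have [] := c1 j.
by apply: continuous_funM => //; have [] := c1 i.
Qed.

Lemma norm2_gradient_continuous Omega phi x : C2_on Omega phi -> Omega x ->
  {for x, continuous (fun z => norm2 (gradient phi z))}.
Proof.
move=> [C1 _] Ox; have [_ c1] := C1 x Ox.
apply: (@continuous_comp _ _ _ (fun z => \sum_(i < n) gradient phi z 0 i ^+ 2)
  Num.sqrt); last exact: sqrt_continuous.
apply: continuous_sum_ord => i.
have -> : (fun z => gradient phi z 0 i ^+ 2) =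
    (fun z => partial i phi z * partial i phi z).
  by apply/funext => z; rewrite mxE.
by apply: continuous_funM; have [] := c1 i.
Qed.

(** The squared Euclidean distance is a polynomial, so functions of it are differentiated without a
    singularity at the centre. *)
Definition sqdist y x : R := \sum_(i < n) (x 0 i - y 0 i) ^+ 2.

Lemma is_derive_coord x v (i : 'I_n) :
  is_derive x v (fun z : V => z 0 i) (v 0 i).
Proof.
apply: is_derive_at0.
have -> : (fun s : R => (s *: v + x) 0 i) = (fun s => v 0 i *: s + x 0 i).
  by apply/funext => s; rewrite !mxE mulrC.
rewrite -[X in is_derive _ _ _ X]addr0.
apply: is_deriveD; rewrite -[X in is_derive _ _ _ X]mulr1; exact: is_deriveZ.
Qed.

Lemma is_derive_sqdist y x (i : 'I_n) :
  is_derive x (delta_mx 0 i) (sqdist y) (2 * (x 0 i - y 0 i)).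
Proof.
have -> : sqdist y = \sum_(j < n) (fun z : V => (z 0 j - y 0 j) ^+ 2).
  by apply/funext => z; rewrite fct_sumE.
have -> : 2 * (x 0 i - y 0 i) =
    \sum_(j < n) (2 * (x 0 j - y 0 j)) * (delta_mx 0 i : V) 0 j.
  rewrite (bigD1 i)//= mxE !eqxx mulr1 big1 ?addr0// => j ji.
  by rewrite mxE eqxx/= (negbTE ji) mulr0.
apply: is_derive_sum => j.
apply: (@is_derive_comp_line _ _ (fun t => (t - y 0 j) ^+ 2)
  (fun z : V => z 0 j)).
  exact: is_derive_sqrB.
exact: is_derive_coord.
Qed.

Lemma coordB_continuous y (i : 'I_n) : continuous (fun z : V => z 0 i - y 0 i).
Proof.
move=> x; apply: continuous_funB; last exact: cst_continuous.
exact: coord_continuous.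
Qed.

Lemma sqdist_continuous y : continuous (sqdist y).
Proof.
move=> x; apply: continuous_sum_ord => i.
by apply: continuous_funM; exact: coordB_continuous.
Qed.

Lemma C2_data_radial Omega y (G G1 G2 : R -> R) :
  (forall x, Omega x -> [/\ is_derive (sqdist y x) (1 : R) G (G1 (sqdist y x)),
     is_derive (sqdist y x) (1 : R) G1 (G2 (sqdist y x)) &
     {for sqdist y x, continuous G2}]) ->
  C2_data Omega (fun x => G (sqdist y x))
    (fun i x => 2 * G1 (sqdist y x) * (x 0 i - y 0 i))
    (fun i j x => 4 * G2 (sqdist y x) * (x 0 i - y 0 i) * (x 0 j - y 0 j) +
                  2 * G1 (sqdist y x) * (i == j)%:R).
Proof.
move=> GP x Ox; have [dG dG1 cG2] := GP x Ox.
have cq := sqdist_continuous y x.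
have cG : {for x, continuous (fun z => G (sqdist y z))}.
  by apply: continuous_comp => //; exact: is_derive_continuous dG.
have cG1 : {for x, continuous (fun z => G1 (sqdist y z))}.
  by apply: continuous_comp => //; exact: is_derive_continuous dG1.
have cG2' : {for x, continuous (fun z => G2 (sqdist y z))}.
  exact: continuous_comp.
have c2G1 : {for x, continuous (fun z => 2 * G1 (sqdist y z))}.
  by apply: continuous_funM => //; exact: cst_continuous.
have c4G2 : {for x, continuous (fun z => 4 * G2 (sqdist y z))}.
  by apply: continuous_funM => //; exact: cst_continuous.
have cx i := coordB_continuous y i x.
split=> // i; split.
- have := is_derive_comp_line _ _ _ _ _ _ dG (is_derive_sqdist y x i).
  by congr (is_derive _ _ _ _); ring.
- by apply: continuous_funM => //; exact: cx.
- move=> j; split.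
    have d1 : is_derive x (delta_mx 0 j) (fun z => G1 (sqdist y z)) _ :=
      is_derive_comp_line _ _ _ _ _ _ dG1 (is_derive_sqdist y x j).
    have d2 := is_derive_coord x (delta_mx 0 j) i.
    have -> : (fun z => 2 * G1 (sqdist y z) * (z 0 i - y 0 i)) =
       (2 \*: (fun z => G1 (sqdist y z)) *
        ((fun z : V => z 0 i) - cst (y 0 i))).
      by [].
    apply: is_derive_eq; rewrite !mxE eqxx/= /GRing.scale/=.
    rewrite !fctE/=; ring.
  apply: continuous_funD.
    apply: continuous_funM; last exact: cx.
    by apply: continuous_funM; last exact: cx.
  by apply: continuous_funM => //; exact: cst_continuous.
Qed.

End C2Data.

(** * Radial functions and the square root of the distance *)

Section FourthRootOfSquaredDistance.
Context {R : realType} {n : nat}.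
Notation V := 'rV[R]_n.
Implicit Types (Omega : set V) (x y : V).

(** With [a = x - y], the gradient is [2 * G1 s * a], and the Hessian is the sum of [4 * G2 s] times
    the rank-one matrix of [a] and [2 * G1 s] times the identity; the sum of the squares of [a] is
    [s]. *)
Lemma inf_laplacian_radial Omega y (G G1 G2 : R -> R) x : open Omega ->
  (forall x, Omega x -> [/\ is_derive (sqdist y x) (1 : R) G (G1 (sqdist y x)),
     is_derive (sqdist y x) (1 : R) G1 (G2 (sqdist y x)) &
     {for sqdist y x, continuous G2}]) ->
  Omega x -> let s := sqdist y x in
  inf_laplacian (fun z => G (sqdist y z)) x =
    8 * G1 s ^+ 2 * s * (G1 s + 2 * s * G2 s).
Proof.
move=> Oo /C2_data_radial C Ox s; rewrite /inf_laplacian.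
pose a i := x 0 i - y 0 i.
have sE : \sum_(i < n) a i ^+ 2 = s by [].
transitivity (\sum_(i < n) \sum_(j < n)
   (16 * G1 s ^+ 2 * G2 s * a i ^+ 2 * a j ^+ 2 +
   (8 * G1 s ^+ 3 * a i ^+ 2) * (i == j)%:R)).
  apply: eq_bigr => i _; apply: eq_bigr => j _.
  rewrite (C2_data_partial2 _ _ _ _ _ _ _ Oo C)//.
  rewrite !(C2_data_partial _ _ _ _ _ _ C)// -/s -/(a i) -/(a j).
  by have [->|_] := eqVneq i j; rewrite /=; ring.
transitivity (\sum_(i < n)
    (16 * G1 s ^+ 2 * G2 s * s + 8 * G1 s ^+ 3) * a i ^+ 2).
  apply: eq_bigr => i _; rewrite big_split/= -mulr_sumr.
  rewrite [X in _ + X](bigD1 i)//= eqxx [X in _ + (_ + X)]big1 => [|j ji].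
    by rewrite sE mulr1 addr0; ring.
  by rewrite eq_sym (negbTE ji) mulr0.
by rewrite -mulr_sumr sE; ring.
Qed.

Lemma norm2_gradient_radial Omega y (G G1 G2 : R -> R) x :
  (forall x, Omega x -> [/\ is_derive (sqdist y x) (1 : R) G (G1 (sqdist y x)),
     is_derive (sqdist y x) (1 : R) G1 (G2 (sqdist y x)) &
     {for sqdist y x, continuous G2}]) ->
  Omega x -> let s := sqdist y x in
  norm2 (gradient (fun z => G (sqdist y z)) x) = Num.sqrt (4 * G1 s ^+ 2 * s).
Proof.
move=> /C2_data_radial C Ox s; congr Num.sqrt.
have -> : s = \sum_(i < n) (x 0 i - y 0 i) ^+ 2 by [].
rewrite mulr_sumr; apply: eq_bigr => i _.
by rewrite mxE (C2_data_partial _ _ _ _ _ _ C)// -/s; ring.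
Qed.

Lemma sqdist_ge0 y x : 0 <= sqdist y x.
Proof. by apply: sumr_ge0 => i _; exact: sqr_ge0. Qed.

Lemma sqdistxx x : sqdist x x = 0.
Proof. by apply: big1 => i _; rewrite subrr expr0n. Qed.

Lemma sqdist_eq0 y x : sqdist y x = 0 -> x = y.
Proof.
move=> /eqP; rewrite psumr_eq0 => [/allP q0|i _]; last exact: sqr_ge0.
apply/rowP => i; have := q0 i; rewrite mem_index_enum => /(_ isT).
by rewrite sqrf_eq0 subr_eq0 => /eqP.
Qed.

Lemma sqdist_gt0 y x : x <> y -> 0 < sqdist y x.
Proof.
by move=> xy; rewrite lt_neqAle sqdist_ge0 andbT; apply/eqP => /esym/sqdist_eq0.
Qed.

Lemma sqdistC y x : sqdist y x = sqdist x y.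
Proof. by apply: eq_bigr => i _; rewrite -sqrrN opprB. Qed.

(** For [d = 0] this is the square root of the Euclidean distance; [d > 0] smooths it at the
    centre. *)
Definition root4 (d : R) y x : R := (sqdist y x + d) `^ (4^-1).

Let G (a b d s : R) : R := a + b * (s + d) `^ (4^-1).
Let G1 (b d s : R) : R := b * (4^-1 * (s + d) `^ (4^-1 - 1)).
Let G2 (b d s : R) : R := b * (4^-1 * ((4^-1 - 1) * (s + d) `^ (4^-1 - 1 - 1))).

Let is_derive_powR_shift (r d s : R) : 0 < s + d ->
  is_derive s (1 : R) (fun t => (t + d) `^ r) (r * (s + d) `^ (r - 1)).
Proof.
move=> sd; rewrite -[X in is_derive _ _ _ X]mulr1.
apply: (@is_derive_comp_line _ _ (fun t => t `^ r) (fun t => t + d)).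
  exact: is_derive1_powR.
exact: is_derive_shift.
Qed.

Let GP Omega (a b d : R) y : (forall x, Omega x -> 0 < sqdist y x + d) ->
  forall x, Omega x ->
    [/\ is_derive (sqdist y x) (1 : R) (G a b d) (G1 b d (sqdist y x)),
     is_derive (sqdist y x) (1 : R) (G1 b d) (G2 b d (sqdist y x)) &
     {for sqdist y x, continuous (G2 b d)}].
Proof.
move=> q0 x /q0 sd; rewrite /G /G1 /G2.
have D r := is_derive_powR_shift r d _ sd.
split.
- rewrite -[X in is_derive _ _ _ X]add0r; apply: is_deriveD.
  exact: is_deriveZ.
- apply: continuous_funM; first exact: cst_continuous.
  apply: continuous_funM; first exact: cst_continuous.
  apply: continuous_funM; first exact: cst_continuous.
  exact: is_derive_continuous (D _).
Qed.

Lemma C2_on_root4 Omega (a b d : R) y : open Omega ->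
  (forall x, Omega x -> 0 < sqdist y x + d) ->
  C2_on Omega (fun x => a + b * root4 d y x).
Proof.
move=> Oo q0.
exact: C2_data_on Oo (C2_data_radial _ _ _ _ _ (GP Omega a b d y q0)).
Qed.

Lemma powRB1 (r t : R) : 0 < t -> t `^ (r - 1) = t `^ r / t.
Proof.
by move=> t0; rewrite powRB ?powRr1 ?(ltW t0)// (gt_eqF t0) implybT.
Qed.

(** Away from the centre the sign is that of [b * (2 * d - s)]: opposite to [b] everywhere when
    [d = 0], and opposite to [b] only beyond [s = 2 * d] when [d > 0]. *)
Lemma inf_laplacian_root4 Omega (a b d : R) y x : open Omega ->
  (forall x, Omega x -> 0 < sqdist y x + d) -> Omega x ->
  let s := sqdist y x in
  exists2 k, 0 < k &
    inf_laplacian (fun x => a + b * root4 d y x) x =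
      k * s * b ^+ 3 * (2 * d - s).
Proof.
move=> Oo q0 Ox s.
have -> := inf_laplacian_radial _ _ _ _ _ _ Oo (GP Omega a b d y q0) Ox.
have t0 := q0 x Ox.
rewrite -/s in t0 *; rewrite /G1 /G2 !powRB1//.
set t := s + d in t0 *; have w0 : 0 < t `^ 4^-1 by exact: powR_gt0.
exists (8 * (4^-1 * (t `^ 4^-1 / t)) ^+ 2 * (8^-1 * t `^ 4^-1 / t ^+ 2)).
  have wt0 : 0 < t `^ 4^-1 / t by exact: divr_gt0.
  have w80 : 0 < 8^-1 * t `^ 4^-1 by rewrite mulr_gt0.
  by rewrite mulr_gt0 ?divr_gt0 ?exprn_gt0// mulr_gt0 ?exprn_gt0// mulr_gt0.
have -> : s = t - d by rewrite addrK.
by field; rewrite gt_eqF.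
Qed.

(** The norm of the gradient is [|b| / (2 * w)], where [w] is the square root of the distance. *)
Lemma norm2_gradient_root4 Omega (a b : R) y x : open Omega ->
  (forall x, Omega x -> 0 < sqdist y x + 0) -> Omega x ->
  2 * root4 0 y x <= `|b| ->
  1 <= norm2 (gradient (fun x => a + b * root4 0 y x) x).
Proof.
move=> Oo q0 Ox b2.
have -> := norm2_gradient_radial _ _ _ _ _ _ (GP Omega a b 0 y q0) Ox.
rewrite -[leLHS]sqrtr1 ler_wsqrtr// /G1 powRB1; last exact: q0.
have s0 := q0 x Ox; move: b2 s0; rewrite /root4 addr0.
set s := sqdist y x; set w := s `^ 4^-1 => b2 s0.
have w0 : 0 < w by exact: powR_gt0.
have w4 : w ^+ 4 = s.
  by rewrite -powR_mulrn ?ltW// -powRrM mulVf ?powRr1 ?ltW// pnatr_eq0.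
have -> : 4 * (b * (4^-1 * (w / s))) ^+ 2 * s = b ^+ 2 / (2 * w) ^+ 2.
  by rewrite -w4; field; rewrite gt_eqF.
rewrite ler_pdivlMr ?exprn_gt0 ?mulr_gt0// mul1r -(real_normK (num_real b)).
by rewrite ler_sqr// nnegrE mulr_ge0// ltW.
Qed.

End FourthRootOfSquaredDistance.

(** * Comparison with strict supersolutions *)

Section Comparison.
Context {R : realType} {n : nat}.
Notation V := 'rV[R]_n.
Implicit Types (Omega D U K : set V) (v phi w : V -> R) (x y z : V).

(** Each coordinate difference is at most the Euclidean distance, so sup-norm balls contain
    Euclidean ones. *)
Lemma nbhs_sqdist x (P : V -> Prop) : (\forall y \near x, P y) ->
  exists2 r : R, 0 < r & forall y, sqdist x y < r -> P y.
Proof.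
move=> /nbhs_ballP[e /= e0 eP]; exists (e ^+ 2); first exact: exprn_gt0.
move=> y yr; apply: eP; split=> // i j.
rewrite -ball_normE /ball_/= (ord1 i) distrC.
rewrite -(@ltr_pXn2r _ 2) ?nnegrE ?(ltW e0)//.
rewrite real_normK ?num_real//; apply: le_lt_trans yr.
rewrite /sqdist (bigD1 j)//= lerDl; apply: sumr_ge0 => k _; exact: sqr_ge0.
Qed.

Lemma sqdist_nbhs x (r : R) : 0 < r -> \forall y \near x, sqdist x y < r.
Proof.
move=> r0; apply: continuous_near_lt; last by rewrite sqdistxx.
exact: sqdist_continuous.
Qed.

Lemma sqdist_triangle x y z : sqdist x z <= 2 * sqdist x y + 2 * sqdist y z.
Proof.
rewrite /sqdist !mulr_sumr -big_split/=; apply: ler_sum => i _.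
have := sqr_ge0 ((z 0 i - y 0 i) - (y 0 i - x 0 i)); nra.
Qed.

Lemma closed_sqdist_le x (r : R) : closed [set y | sqdist x y <= r].
Proof.
apply: (@preimage_closed _ _ (sqdist x) [set t | t <= r]);
  last exact: closed_le.
by move=> y _; exact: sqdist_continuous.
Qed.

Lemma max_on_closed Omega K w : bounded_set Omega -> K `<=` Omega ->
  closed K -> K !=set0 -> (forall x, K x -> {for x, continuous w}) ->
  exists2 x, K x & forall y, K y -> w y <= w x.
Proof.
move=> bO KO cK K0 wc.
have bK : bounded_set K.
  by case: bO => M [Mr MO]; exists M; split=> // m mM t /KO; exact: MO.
have cptK := bounded_closed_compact bK cK.
have [|c] := EVT_max_rV K0 cptK (f := w).
  by apply: continuous_in_subspaceT => x; rewrite inE; exact: wc.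
by rewrite inE => Kc cmax; exists c => // y Ky; apply: cmax; rewrite inE.
Qed.

(* The touching maximum is not required to be strict, and [v] is continuous
   rather than upper semicontinuous: the members of the Perron family can be
   taken of this stronger kind. *)
Definition subsolution Omega D v :=
  (forall x, Omega x -> {for x, continuous v}) /\
  forall x phi, Omega x -> C2_on Omega phi ->
    (\forall y \near x, v y - phi y <= v x - phi x) ->
    0 <= inf_laplacian phi x /\ \1_(D°) x <= norm2 (gradient phi x).

Lemma C2_on_continuous Omega phi x : C2_on Omega phi -> Omega x ->
  {for x, continuous phi}.
Proof. by move=> [C1 _] Ox; have [] := C1 x Ox. Qed.

(** A positive value of [v - phi] would produce an interior maximum of [v - phi]; there [phi] is a
    test function with negative infinity Laplacian, contradicting the subsolution property. *)
Lemma comparison Omega D U v phi : bounded_set Omega ->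
  open U -> U `<=` Omega -> subsolution Omega D v -> C2_on Omega phi ->
  (forall x, U x -> inf_laplacian phi x < 0) ->
  (forall z, closure U z -> ~ U z -> forall e, 0 < e ->
     \forall x \near z, U x -> v x < phi x + e) ->
  forall x, U x -> v x <= phi x.
Proof.
move=> bO Uo UO [vc vs] C2 Lneg vbd x Ux; rewrite leNgt; apply/negP => phiv.
pose w z := v z - phi z.
have wc z : U z -> {for z, continuous w}.
  move=> Uz; apply: continuous_funB; first by apply: vc; exact: UO.
  by apply: C2_on_continuous C2 _; exact: UO.
have m0 : 0 < w x by rewrite subr_gt0.
pose K := U `&` [set z | w x <= w z].
(* A limit point of [K] outside [U] would be a boundary point of [U], and [vbd] with [e = w x] keeps
   [v - phi] below [w x] near it. *)
have cK : closed K.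
  move=> z Kz.
  have Uz : U z.
    apply: contrapT => Uz.
    have /(vbd z)/(_ Uz (w x) m0) vz : closure U z.
      by apply: closure_subset Kz => t [].
    have [t [[Ut /= wt] /(_ Ut)]] := Kz _ vz.
    by move: wt; rewrite /w; lra.
  split=> //=; rewrite leNgt; apply/negP => wzx.
  have Nz : nbhs z [set t | w t < w x].
    exact: continuous_near_lt (wc z Uz) wzx.
  by have [t [[Ut /= wt]]] := Kz _ Nz; rewrite /= ltNge wt.
have [|||z [Uz wz] zmax] := @max_on_closed Omega K w bO _ cK.
- by move=> t [/UO].
- by exists x; split=> //=.
- by move=> t [/wc].
have [|+ _] := vs z phi (UO _ Uz) C2; last by rewrite leNgt Lneg.
near=> t; have [tx|tx] := leP (w x) (w t).
  by apply: zmax; split=> //; near: t; exact: open_nbhs_nbhs.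
exact: le_trans (ltW tx) wz.
Unshelve. all: by end_near. Qed.

(* Comparison on an annulus around [y] with a multiple of [root4 d y], which is
   strictly infinity-superharmonic where [sqdist y > 2 * d], for small [d]. *)
Lemma subsolution_growth Omega D v y x (r M : R) : bounded_set Omega ->
  open Omega -> subsolution Omega D v -> 0 < r ->
  (forall z, sqdist y z <= r -> Omega z) ->
  (forall z, Omega z -> v z <= M) -> sqdist y x <= r / 2 ->
  v x <= v y + (M - v y) * ((2 * sqdist y x) `^ 4^-1 / r `^ 4^-1).
Proof.
move=> bO Oo vsub r0 yO vM yx.
have Oy : Omega y by apply: yO; rewrite sqdistxx ltW.
have [->|xy] := pselect (x = y).
  by rewrite sqdistxx mulr0 powR0// mul0r mulr0 addr0.
have s0 : 0 < sqdist y x by exact: sqdist_gt0.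
set s := sqdist y x in yx s0 *; set th := _ / r `^ _.
have rw0 : 0 < r `^ 4^-1 by exact: powR_gt0.
have th0 : 0 <= th by rewrite divr_ge0 ?powR_ge0.
suff H e : 0 < e -> v x <= v y + e + (M - v y + e) * th.
  apply/ler_addgt0Pr => e e0.
  (* The error in [H] adds up to [e * (1 + th)]. *)
  have := H (e / (1 + th)); rewrite divr_gt0 ?ltr_wpDr// => /(_ isT).
  have : e / (1 + th) * (1 + th) = e by rewrite divfK// gt_eqF// ltr_wpDr.
  set k := e / _ => ke; nra.
move=> e0; have [vc _] := vsub.
have [r1 r10 vr1] : exists2 r1 : R, 0 < r1 &
    forall z, sqdist y z < r1 -> v z < v y + e.
  by apply: nbhs_sqdist; apply: continuous_near_lt; [exact: vc | rewrite ltrDl].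
(* Since [2 * d] is at most [s / 2] and [r1 / 2], the point [x] lies outside the inner sphere
   [sqdist y z = 2 * d], and on that sphere [v < v y + e]. *)
pose d := Num.min (s / 2) (r1 / 2) / 2.
have m0 : 0 < Num.min (s / 2) (r1 / 2) by rewrite lt_min !divr_gt0.
have d0 : 0 < d by rewrite divr_gt0.
have ds : 2 * d <= s / 2 by rewrite /d mulrC divfK// ge_min lexx.
have dr1 : 2 * d <= r1 / 2 by rewrite /d mulrC divfK// ge_min lexx orbT.
(* This slope makes [phi] exceed [M] on the outer sphere [sqdist y z = r]. *)
pose B := (M - v y + e) / r `^ 4^-1.
have B0 : 0 < B by rewrite divr_gt0// ltr_wpDl// subr_ge0 vM.
pose phi z := (v y + e) + B * root4 d y z.
pose U := [set z | sqdist y z < r] `&` [set z | 2 * d < sqdist y z].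
have q0 z : Omega z -> 0 < sqdist y z + d.
  by move=> _; rewrite ltr_wpDl// sqdist_ge0.
have C2 : C2_on Omega phi by exact: C2_on_root4.
have UO : U `<=` Omega by move=> z [/= zr _]; apply: yO; exact: ltW.
have Uo : open U.
  apply: openI.
    apply: (@open_comp _ _ (sqdist y) [set t | t < r]); last exact: open_lt.
    by move=> ? _; exact: sqdist_continuous.
  apply: (@open_comp _ _ (sqdist y) [set t | 2 * d < t]); last exact: open_gt.
  by move=> ? _; exact: sqdist_continuous.
have Lneg z : U z -> inf_laplacian phi z < 0.
  move=> /[dup] Uz [/= zr zd].
  have [k k0 ->] := inf_laplacian_root4 Omega (v y + e) B d y z Oo q0 (UO _ Uz).
  have sz0 : 0 < sqdist y z by apply: lt_trans zd; rewrite mulr_gt0.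
  have B3 : 0 < B ^+ 3 by exact: exprn_gt0.
  have kB : 0 < k * sqdist y z * B ^+ 3.
    by apply: mulr_gt0 => //; exact: mulr_gt0.
  by rewrite pmulr_rlt0 ?subr_lt0.
have vphi : v x <= phi x.
  have Ux : U x by split=> /=; rewrite -/s; lra.
  apply: (comparison Omega D U v phi bO Uo UO vsub C2 Lneg _ x Ux).
  move=> z cU nU.
  have Ez : [set t | sqdist y t <= r] z /\ [set t | 2 * d <= sqdist y t] z.
    split; [apply: (closed_sqdist_le y r)|].
      by apply: closure_subset cU => t [/ltW].
    have cd : closed [set t | 2 * d <= sqdist y t].
      apply: (@preimage_closed _ _ (sqdist y) [set t | 2 * d <= t]);
        last exact: closed_ge.
      by move=> t _; exact: sqdist_continuous.
    by apply: cd; apply: closure_subset cU => t [_ /ltW].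
  have [/= zr zd] := Ez.
  have Oz : Omega z by exact: yO.
  have vphiz : v z <= phi z.
    (* A point of the closure of the annulus outside the annulus is on the inner or on the outer
       sphere. *)
    have [zr'|zr'] := ltP (sqdist y z) r.
      have zd' : sqdist y z <= 2 * d.
        by rewrite leNgt; apply/negP => zd'; apply: nU.
      have : v z < v y + e by apply: vr1; lra.
      have : 0 <= B * root4 d y z by rewrite mulr_ge0 ?powR_ge0// ltW.
      by rewrite /phi; lra.
    have : r `^ 4^-1 <= root4 d y z.
      by apply: ge0_ler_powR; rewrite ?nnegrE; lra.
    have Br : B * r `^ 4^-1 = M - v y + e by rewrite /B divfK// gt_eqF.
    move=> /(ler_wpM2l (ltW B0)); rewrite Br /phi.
    by have := vM _ Oz; lra.
  move=> e' e'0.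
  have : \forall t \near z, v t - phi t < e'.
    apply: continuous_near_lt; last by lra.
    apply: continuous_funB; first exact: vc.
    exact: C2_on_continuous C2 Oz.
  by apply: filterS => t; lra.
apply: (le_trans vphi); rewrite /phi lerD2l.
have -> : B * root4 d y x = (M - v y + e) * (root4 d y x / r `^ 4^-1).
  by rewrite /B mulrAC mulrA.
have A0 : 0 <= M - v y + e by have := vM _ Oy; lra.
rewrite ler_wpM2l ?ler_wpM2r ?invr_ge0 ?(ltW rw0)//.
(* The factor 2 in the estimate comes from [s + d <= 2 * s]. *)
by apply: ge0_ler_powR; rewrite ?nnegrE -/s; lra.
Qed.

End Comparison.

(** * The Perron family and its barriers *)

Section PerronFamily.
Context {R : realType} {n : nat}.
Notation V := 'rV[R]_n.
Implicit Types (Omega D : set V) (f u v phi psi : V -> R) (x y z w : V).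

Lemma indic_le1 D x : \1_D x <= 1 :> R.
Proof. by rewrite indicE; case: (_ \in _). Qed.

Lemma norm2_ge0 (v : V) : 0 <= norm2 v.
Proof. exact: sqrtr_ge0. Qed.

Lemma powR4_lt (t e : R) : 0 <= t -> 0 < e -> t < e ^+ 4 -> t `^ 4^-1 < e.
Proof.
move=> t0 e0 te; have e4 : (e ^+ 4) `^ 4^-1 = e.
  by rewrite -powR_mulrn ?ltW// -powRrM mulfV ?powRr1 ?ltW// pnatr_eq0.
rewrite -[ltRHS]e4; apply: gt0_ltr_powR; rewrite ?nnegrE ?invr_gt0//.
by rewrite exprn_ge0// ltW.
Qed.

Lemma root4_near0 z (e : R) : 0 < e -> \forall x \near z, root4 0 z x < e.
Proof.
move=> e0; have := sqdist_nbhs z (e ^+ 4) (exprn_gt0 _ e0).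
apply: filterS => x; rewrite /root4 addr0.
by apply: powR4_lt; rewrite ?sqdist_ge0.
Qed.

Lemma root4xx z : root4 0 z z = 0.
Proof. by rewrite /root4 sqdistxx addr0 powR0// invr_neq0// pnatr_eq0. Qed.

(** At the centre [root4 0 z] takes its least value 0; elsewhere it is of class C^2, hence
    continuous. *)
Lemma root4_lower_semicontinuous z w (e : R) : 0 < e ->
  \forall x \near w, root4 0 z w < root4 0 z x + e.
Proof.
move=> e0; have [->|wz] := pselect (w = z).
  by near=> x; rewrite root4xx ltr_wpDl// powR_ge0.
pose W := [set x | 0 < sqdist z x].
have Wo : open W.
  apply: (@open_comp _ _ (sqdist z) [set t | 0 < t]); last exact: open_gt.
  by move=> ? _; exact: sqdist_continuous.
have q0 x : W x -> 0 < sqdist z x + 0 by rewrite addr0.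
have C2 := C2_on_root4 W 0 1 0 z Wo q0.
have := continuous_near_gt _ w (root4 0 z w - e)
  (C2_on_continuous _ _ w C2 (sqdist_gt0 _ _ wz)).
rewrite add0r mul1r ltrBlDr ltrDl => /(_ e0); apply: filterS => x; lra.
Unshelve. all: by end_near. Qed.

Definition boundary_below Omega f v := forall z, boundary Omega z ->
  forall e, 0 < e -> \forall x \near z, Omega x -> v x < f z + e.

Definition perron_family Omega D f : set (V -> R) :=
  [set v | subsolution Omega D v /\ boundary_below Omega f v].

(** Classical subsolutions are viscosity subsolutions: by [touching], the test function inherits the
    gradient and has at least the same infinity Laplacian. *)
Lemma classical_test Omega D phi psi x : open Omega -> C2_on Omega phi ->
  C2_on Omega psi -> Omega x ->
  0 <= inf_laplacian phi x -> \1_(D°) x <= norm2 (gradient phi x) ->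
  (\forall y \near x, phi y - psi y <= phi x - psi x) ->
  0 <= inf_laplacian psi x /\ \1_(D°) x <= norm2 (gradient psi x).
Proof.
move=> Oo Cphi Cpsi Ox L G /(touching _ _ _ _ Oo Cphi Cpsi Ox)[<- L'].
by split=> //; exact: le_trans L L'.
Qed.

Lemma boundary_open Omega z : open Omega ->
  (boundary Omega z <-> closure Omega z /\ ~ Omega z).
Proof. by move=> /interior_id OE; rewrite /boundary OE. Qed.

(** As [z] is outside [Omega], the function is smooth in [Omega]; its infinity Laplacian is
    nonnegative there, and the bound on [root4] makes its gradient at least 1, whatever [D] is. *)
Lemma lower_barrier Omega D f z (a b : R) : open Omega -> ~ Omega z -> 0 < b ->
  (forall x, Omega x -> 2 * root4 0 z x <= b) ->
  (forall w, boundary Omega w -> a - b * root4 0 z w <= f w) ->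
  perron_family Omega D f (fun x => a + (- b) * root4 0 z x).
Proof.
move=> Oo Oz b0 Ob bf.
have q0 x : Omega x -> 0 < sqdist z x + 0.
  by move=> Ox; rewrite addr0; apply: sqdist_gt0 => xz; rewrite xz in Ox.
have C2 := C2_on_root4 Omega a (- b) 0 z Oo q0.
split.
  split=> [x Ox|x phi Ox Cphi xmax]; first exact: C2_on_continuous C2 Ox.
  apply: (classical_test Omega D _ phi x Oo C2 Cphi Ox _ _ xmax).
    have [k k0 ->] := inf_laplacian_root4 Omega a (- b) 0 z x Oo q0 Ox.
    have -> : k * sqdist z x * (- b) ^+ 3 * (2 * 0 - sqdist z x) =
      k * (sqdist z x * sqdist z x) * b ^+ 3 by ring.
    rewrite mulr_ge0 ?exprn_ge0 ?(ltW b0)//.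
    by rewrite mulr_ge0 ?(ltW k0) ?mulr_ge0 ?sqdist_ge0.
  apply: (le_trans (indic_le1 _ _)).
  apply: (norm2_gradient_root4 Omega a (- b) z x Oo q0 Ox).
  by rewrite normrN gtr0_norm// Ob.
move=> w bw e e0.
have := root4_lower_semicontinuous z w (e / b) (divr_gt0 e0 b0).
apply: filterS => x; rewrite -(ltr_pM2l b0) mulrDr mulrCA mulfV ?gt_eqF// mulr1.
by have := bf w bw; lra.
Qed.

(** For [d = 0] and [b > 0] the radial function is strictly infinity-superharmonic in all of
    [Omega], so [comparison] applies with [U = Omega]. *)
Lemma upper_barrier Omega D f v z (a b : R) : bounded_set Omega ->
  open Omega -> ~ Omega z -> 0 < b ->
  (forall w, boundary Omega w -> f w <= a + b * root4 0 z w) ->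
  perron_family Omega D f v ->
  forall x, Omega x -> v x <= a + b * root4 0 z x.
Proof.
move=> bO Oo Oz b0 fb [vs vf].
have q0 x : Omega x -> 0 < sqdist z x + 0.
  by move=> Ox; rewrite addr0; apply: sqdist_gt0 => xz; rewrite xz in Ox.
have C2 := C2_on_root4 Omega a b 0 z Oo q0.
apply: (comparison Omega D Omega v _ bO Oo _ vs C2) => // [x Ox|w cw nw e e0].
  have [k k0 ->] := inf_laplacian_root4 Omega a b 0 z x Oo q0 Ox.
  have -> : k * sqdist z x * b ^+ 3 * (2 * 0 - sqdist z x) =
      - (k * (sqdist z x * sqdist z x) * b ^+ 3) by ring.
  have s0 := q0 x Ox; rewrite addr0 in s0.
  rewrite oppr_lt0; apply: mulr_gt0; last exact: exprn_gt0.
  by apply: mulr_gt0 => //; exact: mulr_gt0.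
have bw : boundary Omega w by apply/boundary_open.
have e20 : 0 < e / 2 by rewrite divr_gt0.
near=> x => Ox.
have : v x < f w + e / 2 by move: Ox; near: x; exact: vf.
have : b * root4 0 z w < b * (root4 0 z x + e / 2 / b).
  rewrite ltr_pM2l//; near: x; apply: root4_lower_semicontinuous.
  by rewrite divr_gt0.
rewrite mulrDr [b * (_ / b)]mulrCA mulfV ?gt_eqF// mulr1.
by have := fb w bw; lra.
Unshelve. all: by end_near. Qed.

Lemma quartic_data Omega x0 (c : R) :
  C2_data Omega (fun x => c * sqdist x0 x ^+ 2)
    (fun i x => 2 * (c * (2 * sqdist x0 x)) * (x 0 i - x0 0 i))
    (fun i j x => 4 * (c * 2) * (x 0 i - x0 0 i) * (x 0 j - x0 0 j) +
                  2 * (c * (2 * sqdist x0 x)) * (i == j)%:R).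
Proof.
apply: (C2_data_radial Omega x0 (fun s => c * s ^+ 2) (fun s => c * (2 * s))
  (fun=> c * 2)) => x Ox.
split; last exact: cst_continuous.
  apply: (is_deriveZ c); have := is_derive_sqrB 0 (sqdist x0 x).
  by rewrite subr0; under eq_fun do rewrite subr0.
apply: (is_deriveZ c); rewrite -[X in is_derive _ _ _ X]mulr1.
exact: (is_deriveZ 2).
Qed.

(* [sqdist x0 ^ 2] vanishes to third order at [x0]. *)
Lemma quartic_perturbation Omega phi x0 (c : R) : open Omega ->
  C2_on Omega phi -> Omega x0 ->
  let psi := fun x => phi x - c * sqdist x0 x ^+ 2 in
  [/\ C2_on Omega psi, gradient psi x0 = gradient phi x0 &
      inf_laplacian psi x0 = inf_laplacian phi x0].
Proof.
move=> Oo C2 Ox psi.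
have C := C2_dataB _ _ _ _ _ _ _ (C2_on_data _ _ C2) (quartic_data Omega x0 c).
have pE i : partial i psi x0 = partial i phi x0.
  by rewrite (C2_data_partial _ _ _ _ _ _ C)// subrr mulr0 subr0.
split; first exact: C2_data_on Oo C.
  by apply/rowP => i; rewrite !mxE pE.
apply: eq_bigr => i _; apply: eq_bigr => j _.
rewrite !pE (C2_data_partial2 _ _ _ _ _ _ _ Oo C)// !subrr sqdistxx.
by rewrite !mulr0 mul0r addr0 subr0.
Qed.

End PerronFamily.

(** * The supremum of the Perron family *)

Section Perron.
Context {R : realType} {n : nat}.
Notation V := 'rV[R]_n.
Variables (Omega D : set V) (f v0 : V -> R) (m M : R).
Hypotheses (bO : bounded_set Omega) (Oo : open Omega).
Hypothesis v0P : perron_family Omega D f v0.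
Hypothesis v0m : forall x, Omega x -> m <= v0 x.
Hypothesis famM : forall v x, perron_family Omega D f v -> Omega x -> v x <= M.
Implicit Types (v phi psi : V -> R) (x y z : V).

(** Meaningful on [Omega] only: elsewhere the members of the family take arbitrary values. *)
Definition perron x := sup [set v x | v in perron_family Omega D f].

Let has_sup_perron x : Omega x ->
  has_sup [set v x | v in perron_family Omega D f].
Proof.
move=> Ox; split; first by exists (v0 x), v0.
by exists M => _ [v vP <-]; exact: famM.
Qed.

Lemma perron_ge v x : perron_family Omega D f v -> Omega x -> v x <= perron x.
Proof.
by move=> vP Ox; apply: sup_upper_bound; [exact: has_sup_perron | exists v].
Qed.

Lemma perron_le x (c : R) :
  (forall v, perron_family Omega D f v -> v x <= c) -> perron x <= c.
Proof.
move=> vc; apply: ge_sup; first by exists (v0 x), v0.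
by move=> _ [v vP <-]; exact: vc.
Qed.

Lemma perron_adherent x (e : R) : Omega x -> 0 < e ->
  exists2 v, perron_family Omega D f v & perron x - e < v x.
Proof.
move=> Ox e0; have [_ [v vP <-] ve] := sup_adherent e0 (has_sup_perron x Ox).
by exists v.
Qed.

(** The bound of [subsolution_growth] is nondecreasing in [v y], because the factor of [M - v y] is
    at most 1; hence it passes to the supremum. *)
Lemma perron_growth y x (r : R) : 0 < r ->
  (forall z, sqdist y z <= r -> Omega z) -> sqdist y x <= r / 2 ->
  perron x <= perron y +
    (M - perron y) * ((2 * sqdist y x) `^ 4^-1 / r `^ 4^-1).
Proof.
move=> r0 yO yx; apply: perron_le => v vP.
have Oy : Omega y by apply: yO; rewrite sqdistxx ltW.
have := subsolution_growth Omega D v y x r M bO Oo vP.1 r0 yO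
  (fun z => famM v z vP) yx.
have th1 : (2 * sqdist y x) `^ 4^-1 / r `^ 4^-1 <= 1.
  rewrite ler_pdivrMr ?powR_gt0// mul1r.
  by apply: ge0_ler_powR; rewrite ?nnegrE; have := sqdist_ge0 y x; lra.
set th := _ / _ in th1 *; move=> /le_trans; apply.
by have := perron_ge v y vP Oy; nra.
Qed.

(** [perron_growth] centred at [x] and at [y], with one radius that serves all centres near [x],
    bounds the difference from both sides. *)
Lemma perron_continuous x : Omega x -> {for x, continuous perron}.
Proof.
move=> Ox.
have [r0 r00 r0O] : exists2 r, 0 < r & forall y, sqdist x y < r -> Omega y.
  by apply: nbhs_sqdist; exact: open_nbhs_nbhs.
(* Two steps of squared length at most [r] have total squared length at most [4 * r < r0]. *)
pose r := r0 / 8.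
have r_gt0 : 0 < r by rewrite divr_gt0.
have ballO y : sqdist x y <= r -> forall z, sqdist y z <= r -> Omega z.
  move=> xy z yz; apply: r0O; have := sqdist_triangle x y z.
  by rewrite /r in xy yz *; lra.
have mu z : Omega z -> M - perron z <= M - m.
  by move=> Oz; rewrite lerB// (le_trans (v0m z Oz))// perron_ge.
have mM : 0 <= M - m by rewrite subr_ge0 (le_trans (v0m x Ox))// famM.
have rw0 : 0 < r `^ 4^-1 by exact: powR_gt0.
apply: continuous_dist_lt => e e0.
(* If [2 * sqdist x y < e1 ^+ 4], the growth factor is below [e / (M - m + 1)]. *)
pose e1 := e / (M - m + 1) * r `^ 4^-1.
have e10 : 0 < e1 by rewrite mulr_gt0// divr_gt0// ltr_wpDl.
have e14 : 0 < e1 ^+ 4 / 2 by rewrite divr_gt0// exprn_gt0.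
have r2 : 0 < r / 2 by rewrite divr_gt0.
near=> y.
have xy1 : sqdist x y < e1 ^+ 4 / 2 by near: y; exact: sqdist_nbhs.
have xy2 : sqdist x y < r / 2 by near: y; exact: sqdist_nbhs.
have rx : sqdist x x <= r by rewrite sqdistxx ltW.
have ry : sqdist x y <= r by lra.
have Oy : Omega y by apply: (ballO x rx).
have gy := perron_growth x y r r_gt0 (ballO x rx) (ltW xy2).
have gx : perron x <= perron y +
    (M - perron y) * ((2 * sqdist x y) `^ 4^-1 / r `^ 4^-1).
  have := perron_growth y x r r_gt0 (ballO y ry).
  by rewrite sqdistC; apply; exact: ltW.
have th0 : 0 <= (2 * sqdist x y) `^ 4^-1 / r `^ 4^-1.
  by rewrite divr_ge0 ?powR_ge0.
have the : (2 * sqdist x y) `^ 4^-1 / r `^ 4^-1 < e / (M - m + 1).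
  rewrite ltr_pdivrMr//; apply: powR4_lt => //.
    by rewrite mulr_ge0// sqdist_ge0.
  by rewrite -/e1; lra.
have ee : e / (M - m + 1) * (M - m + 1) = e.
  by rewrite divfK// gt_eqF// ltr_wpDl.
move: th0 the ee gx gy (mu x Ox) (mu y Oy).
set th := _ / _; set e2 := e / _ => th0 the ee gx gy mx my.
have A : (M - m) * th < e by nra.
have A1 := ler_wpM2r th0 mx; have A2 := ler_wpM2r th0 my.
by rewrite ltr_norml; apply/andP; split; lra.
Unshelve. all: by end_near. Qed.

(* If the test function [phi] violated the condition at [x], so would
   [phi + sqdist x ^ 2] near [x]; the latter touches from above, close to [x],
   any member of the family that is almost optimal at [x]. *)
Lemma perron_subsolution : subsolution Omega D perron.
Proof.
split=> [x Ox|x phi Ox C2 umax]; first exact: perron_continuous.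
apply: contrapT => /not_andP bad.
have [] := quartic_perturbation Omega phi x (-1) Oo C2 Ox.
set psi := fun y => phi y - _ => Cpsi Gpsi Lpsi.
have badn : \forall y \near x, ~ (0 <= inf_laplacian psi y /\
    \1_(D°) y <= norm2 (gradient psi y)).
  case: bad => /negP; rewrite -ltNge => bad.
    have : \forall y \near x, inf_laplacian psi y < 0.
      apply: continuous_near_lt; last by rewrite Lpsi.
      exact: inf_laplacian_continuous Cpsi Ox.
    by apply: filterS => y yneg [+ _]; rewrite leNgt yneg.
  (* The gradient inequality can fail only in the open set [D°], where the indicator is locally
     constant, so the failure persists near [x]. *)
  have Dx : D° x.
    apply: contrapT => Dx; move: bad.
    by rewrite indicE memNset// ltNge norm2_ge0.
  have g1 : norm2 (gradient psi x) < 1.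
    by rewrite Gpsi; exact: lt_le_trans bad (indic_le1 _ _).
  have g1n := continuous_near_lt _ _ _
    (norm2_gradient_continuous _ _ _ Cpsi Ox) g1.
  have Dn : \forall y \near x, D° y.
    by apply: open_nbhs_nbhs; split => //; exact: open_interior.
  near=> y => -[_].
  have Dy : D° y by near: y.
  by rewrite indicE mem_set// leNgt => /negP; apply; near: y.
have On : \forall y \near x, Omega y by exact: open_nbhs_nbhs.
have [r1 r10 r1P] : exists2 r, 0 < r & forall y, sqdist x y < r ->
    [/\ Omega y, perron y - phi y <= perron x - phi x &
     ~ (0 <= inf_laplacian psi y /\ \1_(D°) y <= norm2 (gradient psi y))].
  by apply: nbhs_sqdist; near=> y; split; near: y.
pose r := r1 / 2.
have r0 : 0 < r by rewrite divr_gt0.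
have rP y : sqdist x y <= r -> [/\ Omega y,
    perron y - phi y <= perron x - phi x &
    ~ (0 <= inf_laplacian psi y /\ \1_(D°) y <= norm2 (gradient psi y))].
  by move=> xy; apply: r1P; rewrite /r in xy; lra.
(* On the sphere [sqdist x y = r] the quartic term equals [r ^+ 2], more than [v] loses at [x]; so
   the maximum of [v - psi] over the ball is interior. *)
have [v vP vx] := perron_adherent x (r ^+ 2) Ox (exprn_gt0 _ r0).
pose K := [set y | sqdist x y <= r].
have Kx : K x by rewrite /K/= sqdistxx ltW.
have [|||y Ky ymax] := @max_on_closed R n Omega K (fun y => v y - psi y) bO _
  (closed_sqdist_le x r) _ _.
- by move=> y /rP[].
- by exists x.
- move=> y /rP[Oy _ _]; apply: continuous_funB; first exact: vP.1.1.
  exact: C2_on_continuous Cpsi Oy.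
have [Oy yle ybad] := rP y Ky; apply: ybad.
have vu := perron_ge v y vP Oy.
have yr : sqdist x y < r.
  rewrite lt_neqAle Ky andbT; apply/eqP => yr.
  have := ymax x Kx; rewrite /psi yr sqdistxx expr0n/= mulr0.
  by move: vx yle vu; lra.
apply: vP.1.2 => //.
have : \forall z \near y, sqdist x z < r.
  by apply: continuous_near_lt => //; exact: sqdist_continuous.
by apply: filterS => z zr; apply: ymax; exact: ltW.
Unshelve. all: by end_near. Qed.

(* Otherwise the maximum of [perron] and of a small lift of
   [phi - sqdist x ^ 2] near [x] would be a larger member of the family. *)
Lemma perron_supersolution x phi : boundary_below Omega f perron ->
  Omega x -> C2_on Omega phi ->
  (\forall y \near x, perron x - phi x <= perron y - phi y) ->
  0 < inf_laplacian phi x ->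
  norm2 (gradient phi x) <= \1_(closure D) x.
Proof.
move=> ubd Ox C2 umin L0; rewrite leNgt; apply/negP => G0.
have [] := quartic_perturbation Omega phi x 1 Oo C2 Ox.
set psi := fun y => phi y - _ => Cpsi Gpsi Lpsi.
have Ln : \forall y \near x, 0 < inf_laplacian psi y.
  apply: continuous_near_gt; last by rewrite Lpsi.
  exact: inf_laplacian_continuous Cpsi Ox.
have Gc := norm2_gradient_continuous _ _ _ Cpsi Ox.
have Gn : \forall y \near x, \1_(D°) y <= norm2 (gradient psi y).
  (* On [closure D] the gradient exceeds 1, also nearby; off it, a whole neighbourhood avoids
     [D°]. *)
  have [Dx|Dx] := pselect (closure D x).
    have : \forall y \near x, 1 < norm2 (gradient psi y).
      apply: continuous_near_gt => //.
      by move: G0; rewrite Gpsi indicE mem_set.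
    by apply: filterS => y /ltW; apply: le_trans; exact: indic_le1.
  have : \forall y \near x, (~` closure D) y.
    by apply: open_nbhs_nbhs; split => //; apply/closed_openC/closed_closure.
  apply: filterS => y Dy; rewrite indicE memNset ?norm2_ge0//.
  by move=> /interior_subset/subset_closure.
have On : \forall y \near x, Omega y by exact: open_nbhs_nbhs.
have [r1 r10 r1P] : exists2 r, 0 < r & forall y, sqdist x y < r ->
    [/\ Omega y, perron x - phi x <= perron y - phi y,
     0 < inf_laplacian psi y & \1_(D°) y <= norm2 (gradient psi y)].
  by apply: nbhs_sqdist; near=> y; split; near: y.
pose r := r1 / 2.
have r0 : 0 < r by rewrite divr_gt0.
have rP y : sqdist x y <= r -> [/\ Omega y,
    perron x - phi x <= perron y - phi y,
     0 < inf_laplacian psi y & \1_(D°) y <= norm2 (gradient psi y)].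
  by move=> xy; apply: r1P; rewrite /r in xy; lra.
(* Where [sqdist x y > r / 2] the quartic term exceeds [r ^+ 2 / 4], hence [k], so the lifted
   function lies below [perron] there and the gluing is continuous. *)
pose k := r ^+ 2 / 8.
have k0 : 0 < k by rewrite divr_gt0// exprn_gt0.
pose c := perron x - phi x + k.
pose w y := if sqdist x y < r then Num.max (perron y) (psi y + c) else perron y.
have uw y : perron y <= w y.
  by rewrite /w; case: ifP => // _; rewrite le_max lexx.
have psiw y : sqdist x y < r -> psi y + c <= w y.
  by rewrite /w => ->; rewrite le_max lexx orbT.
have wu y : r / 2 < sqdist x y -> w y = perron y.
  move=> ry; rewrite /w; case: ifP => // yr.
  apply/max_idPl; have [_ + _ _] := rP y (ltW yr).
  by rewrite /psi /c /k; nra.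
have wP : perron_family Omega D f w.
  split; [split|].
  - move=> y Oy; have [yr|yr] := ltP (sqdist x y) r.
      apply: (near_eq_continuous (fun z => Num.max (perron z) (psi z + c))).
        have : \forall z \near y, sqdist x z < r.
          by apply: continuous_near_lt => //; exact: sqdist_continuous.
        by apply: filterS => z zr; rewrite /w zr.
      apply: continuous_max; first exact: perron_continuous.
      apply: continuous_funD; last exact: cst_continuous.
      exact: C2_on_continuous Cpsi Oy.
    apply: (near_eq_continuous perron); last exact: perron_continuous.
    have : \forall z \near y, r / 2 < sqdist x z.
      by apply: continuous_near_gt; [exact: sqdist_continuous | lra].
    by apply: filterS => z /wu.
  - move=> y phi' Oy C2' wmax.
    (* A function touching [w] from above also touches [perron], or else [psi + c], whichever
       attains [w y]. *)
    have [wy|wy] := eqVneq (w y) (perron y).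
      apply: perron_subsolution.2 => //; apply: filterS wmax => z.
      by rewrite wy; apply: le_trans; rewrite lerD2r.
    have [yr wyE] : sqdist x y < r /\ w y = psi y + c.
      move: wy; rewrite /w; case: ifP => [_|]; last by rewrite eqxx.
      by case: leP => //; rewrite eqxx.
    have [_ _ Ly Gy] := rP y (ltW yr).
    apply: (classical_test Omega D psi phi' y Oo Cpsi C2' Oy (ltW Ly) Gy).
    have zr : \forall z \near y, sqdist x z < r.
      by apply: continuous_near_lt => //; exact: sqdist_continuous.
    near=> z.
    have : w z - phi' z <= w y - phi' y by near: z.
    have : psi z + c <= w z by apply: psiw; near: z.
    by rewrite wyE; lra.
  - move=> z bz e e0.
    have [_ Oz] : closure Omega z /\ ~ Omega z by apply/boundary_open.
    have rz : r / 2 < sqdist x z.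
      rewrite ltNge; apply/negP => zr; apply: Oz.
      have zr' : sqdist x z <= r by lra.
      by have [] := rP z zr'.
    have : \forall y \near z, r / 2 < sqdist x y.
      by apply: continuous_near_gt => //; exact: sqdist_continuous.
    by apply: filterS2 (ubd z bz e e0) => y + /wu ->.
(* At [x] the lift equals [perron x + k], which contradicts maximality. *)
have := perron_ge w x wP Ox.
have : psi x + c <= w x by apply: psiw; rewrite sqdistxx.
by rewrite /psi /c sqdistxx expr0n/= mulr0; lra.
Unshelve. all: by end_near. Qed.

End Perron.

(** * Compactness, boundary moduli and passage to viscosity subsolutions *)

Section BoundaryValues.
Context {R : realType} {n : nat}.
Notation V := 'rV[R]_n.
Implicit Types (Omega D K : set V) (f g v phi : V -> R) (x y z w : V).

Lemma bounded_on_compact K g : compact K -> {within K, continuous g} ->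
  exists2 C : R, 0 < C & forall x, K x -> `|g x| <= C.
Proof.
move=> cK gc; have [C [_ gC]] := compact_bounded (continuous_compact gc cK).
exists (Num.max C 0 + 1); first by rewrite ltr_wpDl// le_max lexx orbT.
move=> x Kx; apply: (gC (Num.max C 0 + 1)); last by exists x.
by rewrite ltr_pwDr// le_max lexx.
Qed.

Lemma compact_closure Omega : bounded_set Omega -> compact (closure Omega).
Proof.
move=> [C [Cr OC]]; apply: bounded_closed_compact; last exact: closed_closure.
exists C; split=> // C' CC' x.
have cC : closed [set y : V | `|y| <= C'].
  apply: (@preimage_closed _ _ (fun y : V => `|y|) [set t | t <= C']).
    by move=> ? _; exact: norm_continuous.
  exact: closed_le.
by move=> cx; apply: cC; apply: closure_subset cx; exact: OC.
Qed.

Lemma compact_boundary Omega : bounded_set Omega -> compact (boundary Omega).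
Proof.
move=> bO; apply: subclosed_compact (compact_closure _ bO) _; last first.
  by move=> x [].
apply: closedI; first exact: closed_closure.
by apply: open_closedC; exact: open_interior.
Qed.

Lemma sqdist_bounded Omega z : bounded_set Omega ->
  exists2 C : R, 0 < C & forall x, Omega x -> sqdist z x <= C.
Proof.
move=> /compact_closure cO.
have [|C C0 CP] := bounded_on_compact _ (sqdist z) cO.
  by apply: continuous_subspaceT; exact: sqdist_continuous.
by exists C => // x /subset_closure/CP; rewrite ger0_norm// sqdist_ge0.
Qed.

Lemma root4_bounded Omega z : bounded_set Omega ->
  exists2 C : R, 0 < C & forall x, Omega x -> root4 0 z x <= C.
Proof.
move=> /(sqdist_bounded _ z)[C C0 CP].
exists (C `^ 4^-1); first exact: powR_gt0.
move=> x /CP xC; rewrite /root4 addr0.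
by apply: ge0_ler_powR; rewrite ?nnegrE ?sqdist_ge0 ?invr_ge0 ?(ltW C0).
Qed.

Lemma bounded_set_notin Omega : (0 < n)%N -> bounded_set Omega ->
  exists z, ~ Omega z.
Proof.
move=> n0 /(sqdist_bounded _ 0)[C C0 CP].
exists (const_mx (C + 1)) => /CP; apply/negP; rewrite -ltNge.
rewrite /sqdist (bigD1 (Ordinal n0))//= !mxE subr0.
have : 0 <= \sum_(i < n | i != Ordinal n0)
    ((const_mx (C + 1) : V) 0 i - (0 : V) 0 i) ^+ 2.
  by apply: sumr_ge0 => i _; exact: sqr_ge0.
nra.
Qed.

(** Near [z] continuity of [f] gives the bound [e]; farther away the [root4] term dominates the
    total oscillation of [f]. *)
Lemma boundary_modulus Omega f z (e : R) : bounded_set Omega ->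
  {within boundary Omega, continuous f} -> boundary Omega z -> 0 < e ->
  exists b : R, [/\ 0 < b, forall x, Omega x -> 2 * root4 0 z x <= b &
    forall w, boundary Omega w -> `|f z - f w| <= e + b * root4 0 z w].
Proof.
move=> bO fC bz e0.
have [M M0 fM] := bounded_on_compact _ f (compact_boundary _ bO) fC.
have [C C0 CP] := root4_bounded _ z bO.
have := (subspace_continuousP _ _).1 fC z bz.
move=> /cvgrPdist_lt/(_ e e0) fz.
have [d d0 dP] := nbhs_sqdist z _ fz.
have d40 : 0 < d `^ 4^-1 by exact: powR_gt0.
have b0 : 0 < 2 * M / d `^ 4^-1 by rewrite divr_gt0// mulr_gt0.
(* The first summand absorbs the oscillation [2 * M] at squared distance at least [d]; the second
   gives the gradient bound required by [lower_barrier]. *)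
exists (2 * M / d `^ 4^-1 + 2 * C); split.
- by rewrite addr_gt0// mulr_gt0.
- by move=> x /CP; lra.
move=> w bw; have r0 : 0 <= root4 0 z w by exact: powR_ge0.
have [wd|wd] := ltP (sqdist z w) d.
  have := dP w wd bw => /ltW; move/le_trans; apply.
  by rewrite lerDl mulr_ge0// ltW// addr_gt0// mulr_gt0.
have rd : d `^ 4^-1 <= root4 0 z w.
  apply: ge0_ler_powR; rewrite ?nnegrE ?addr0 ?invr_ge0 ?sqdist_ge0 ?(ltW d0)//.
have : 2 * M <= 2 * M / d `^ 4^-1 * root4 0 z w.
  by rewrite mulrAC ler_pdivlMr// ler_wpM2l// mulr_ge0// ltW.
have := ler_normB (f z) (f w); have := fM z bz; have := fM w bw.
have : 0 <= 2 * C * root4 0 z w by rewrite mulr_ge0// mulr_ge0// ltW.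
by rewrite mulrDl; lra.
Qed.

Lemma near_dnbhs x (P : V -> Prop) : P x -> (\forall y \near x^', P y) ->
  \forall y \near x, P y.
Proof.
move=> Px; rewrite near_withinE; apply: filterS => y.
by have [->|_] := eqVneq y x => // /(_ isT).
Qed.

Lemma subsolution_viscosity Omega D v : open Omega -> subsolution Omega D v ->
  viscosity_subsolution Omega D v.
Proof.
move=> Oo [vc vs]; split=> [x Ox a va|x phi Ox C2 vmax].
  by apply: cvg_within; exact: continuous_near_lt (vc x Ox) va.
have [|L G] := vs x phi Ox C2; last by rewrite le_min L subr_ge0.
by apply: near_dnbhs => //; apply: filterS vmax => y /ltW.
Qed.

End BoundaryValues.

(** * Existence: bounds for the family, boundary values and the viscosity inequalities *)

Theorem theorem3p7 (R : realType) (n : nat) (n_gt0 : (0 < n)%N)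
    (Omega : set 'rV[R]_n) (domOmega : is_domain Omega)
    (bndOmega : bounded_set Omega)
    (f : 'rV[R]_n -> R) (fC : {within boundary Omega, continuous f})
    (D : set 'rV[R]_n) (DOmega : D `<=` Omega) :
  exists u : 'rV[R]_n -> R,
    viscosity_solution Omega D u /\ boundary_condition Omega f u.
Proof.
have [Oo _ _] := domOmega.
have [M1 M10 fM] := bounded_on_compact _ f (compact_boundary _ bndOmega) fC.
have [z0 Oz0] := bounded_set_notin Omega n_gt0 bndOmega.
have [C C0 rC] := root4_bounded _ z0 bndOmega.
have b0 : 0 < 2 * C by rewrite mulr_gt0.
(* A lower barrier centred outside [Omega] and lying below [- M1] shows that the family is
   nonempty. *)
have v0P : perron_family Omega D f (fun x => - M1 + - (2 * C) * root4 0 z0 x).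
  apply: lower_barrier => // [x /rC|w /fM]; first by rewrite ler_pM2l.
  rewrite ler_norml => /andP[+ _]; apply: le_trans.
  by rewrite gerBl mulr_ge0 ?powR_ge0 ?(ltW b0).
have v0m x : Omega x -> - M1 - 2 * C * C <= - M1 + - (2 * C) * root4 0 z0 x.
  by move=> /rC; rewrite lerD2l mulNr lerN2 ler_pM2l.
have famM v x : perron_family Omega D f v -> Omega x -> v x <= M1 + C.
  move=> vP Ox.
  have fM1 w : boundary Omega w -> f w <= M1 + 1 * root4 0 z0 w.
    move=> /fM; rewrite ler_norml => /andP[_ fw]; rewrite (le_trans fw)// lerDl.
    by rewrite mul1r powR_ge0.
  have := upper_barrier _ _ _ _ _ _ _ bndOmega Oo Oz0 ltr01 fM1 vP x Ox.
  by have := rC x Ox; lra.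
pose u := perron Omega D f.
have uc x : Omega x -> {for x, continuous u}.
  exact: (perron_continuous _ _ _ _ _ _ bndOmega Oo v0P v0m famM).
(* Barriers centred at the boundary point [z], with values [f z - e / 2] and [f z + e / 2] there,
   enclose [u]. *)
have near_bd z e : boundary Omega z -> 0 < e ->
    \forall x \near z, Omega x -> `|f z - u x| < e.
  move=> bz e0; have e20 : 0 < e / 2 by rewrite divr_gt0.
  have [b [bpos rb fb]] := boundary_modulus _ _ _ _ bndOmega fC bz e20.
  have [_ Oz] := (boundary_open _ _ Oo).1 bz.
  have lowP : perron_family Omega D f
      (fun x => (f z - e / 2) + (- b) * root4 0 z x).
    apply: lower_barrier => // w /fb; rewrite ler_norml => /andP[_]; lra.
  have fup w : boundary Omega w -> f w <= f z + e / 2 + b * root4 0 z w.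
    by move=> /fb; rewrite ler_norml => /andP[+ _]; lra.
  have e2b : 0 < e / 2 / b by rewrite divr_gt0.
  apply: filterS (root4_near0 z _ e2b) => x; rewrite ltr_pdivlMr// => rx Ox.
  have ulow := perron_ge _ _ _ _ _ v0P famM _ x lowP Ox.
  have uup : u x <= f z + e / 2 + b * root4 0 z x.
    apply: (perron_le _ _ _ _ v0P) => v vP.
    exact: (upper_barrier _ _ _ _ _ _ _ bndOmega Oo Oz bpos fup vP x Ox).
  rewrite ltr_norml; apply/andP; split; move: ulow uup; rewrite -/u; lra.
have ubd : boundary_below Omega f u.
  move=> z bz e e0; apply: filterS (near_bd z e bz e0) => x uf Ox.
  by have := uf Ox; rewrite ltr_norml => /andP[+ _]; lra.
have usub : subsolution Omega D u.
  exact: (perron_subsolution _ _ _ _ _ _ bndOmega Oo v0P v0m famM).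
exists u; split; last first.
  by move=> z bz; apply/cvgrPdist_lt => e e0; exact: near_bd.
split.
- by apply: continuous_in_subspaceT => x; rewrite inE; exact: uc.
- exact: subsolution_viscosity.
split=> [x Ox a ua|x phi Ox C2 umin].
  by apply: cvg_within; exact: continuous_near_gt (uc x Ox) ua.
rewrite ge_min; apply/orP.
have [?|L0] := leP (inf_laplacian phi x) 0; [by left|right].
rewrite subr_le0.
apply: (perron_supersolution _ _ _ _ _ _ bndOmega Oo v0P v0m famM) => //.
by apply: near_dnbhs => //; apply: filterS umin => y /ltW.
Qed.
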